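(* For every graph $G$, the following are equivalent: (1) $G$ is PP-extremal; (2) $\text{pp}(G) = \text{indpp}(G) = \text{ipp}(G) = |V(G)|-\nu(G)$; (3) $G$ has no (connected) components on more than two vertices.
   Context: All graphs are finite, simple, and nonnull (at least one vertex). A path (resp. induced path) in $G$ is a subgraph (resp. induced subgraph) of $G$ that is a path, possibly with only one vertex. An isometric path in $G$ is a path in $G$ that is of smallest possible length (number of edges) among all paths in $G$ between its two endpoints (one-vertex paths are isometric). A path partition (resp. induced path partition, isometric path partition) of $G$ is a collection of paths (resp. induced paths, isometric paths) in $G$ whose vertex sets partition $V(G)$; the smallest cardinality of such a collection is denoted by $\text{pp}(G)$ (resp. $\text{indpp}(G)$, $\text{ipp}(G)$). The matching number $\nu(G)$ is the largest cardinality of a matching of $G$. $G$ is PP-extremal if $\text{pp}(G) = |V(G)|-\nu(G)$. *)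

(* Defs.v *)
From HB Require Import structures.
From mathcomp Require Import all_boot.

Set Implicit Arguments.
Unset Strict Implicit.
Unset Printing Implicit Defensive.

Record sgraph := SGraph {
  vertex :> finType;
  adj : rel vertex;
  adj_sym : symmetric adj;
  adj_irr : irreflexive adj;
  nonnull : 0 < #|vertex| }.

(* A path is encoded by its first vertex and the sequence of the following
   ones.  The bound #|G| on the length of that sequence excludes no path (the
   vertices are distinct); it only makes the paths of G a finType.  A path with
   at least one edge has two encodings, one per direction; since they have the
   same vertices, at most one of them occurs in a path partition. *)
Definition is_path (G : sgraph) (u : G * #|G|.-bseq G) : bool :=
  path (@adj G) u.1 u.2 && uniq (u.1 :: u.2).

Record gpath (G : sgraph) := GPath {
  gpath_val : G * #|G|.-bseq G;
  gpath_prop : is_path gpath_val }.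

HB.instance Definition _ (G : sgraph) := [isSub for @gpath_val G].
HB.instance Definition _ (G : sgraph) := [Finite of gpath G by <:].

Section Paths.
Variable G : sgraph.
Implicit Types (x y : G) (p q : gpath G).

Definition psrc p : G := (val p).1.
Definition ptail p : seq G := (val p).2.
Definition ptgt p : G := last (psrc p) (ptail p).
Definition plength p : nat := size (ptail p).
Definition pseq p : seq G := psrc p :: ptail p.
Definition pverts p : {set G} := [set x in pseq p].

(* Adjacency in the path p itself, as a subgraph of G. *)
Definition padj p : rel G :=
  [rel x y | infix [:: x; y] (pseq p) || infix [:: y; x] (pseq p)].

Definition induced_path p : bool :=
  [forall x in pverts p, forall y in pverts p, adj x y == padj p x y].

(* The edges of G being symmetric, every path of G between the endpoints of p
   has an encoding going from psrc p to ptgt p. *)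
Definition isometric_path p : bool :=
  [forall q : gpath G,
     (psrc q == psrc p) && (ptgt q == ptgt p) ==> (plength p <= plength q)].

(* The vertex sets pverts p are nonempty by construction. *)
Definition path_partition (P : {set gpath G}) : bool :=
  (\bigcup_(p in P) pverts p == [set: G]) &&
  [forall p in P, forall q in P, (p != q) ==> [disjoint pverts p & pverts q]].

Definition induced_path_partition (P : {set gpath G}) : bool :=
  path_partition P && [forall p in P, induced_path p].

Definition isometric_path_partition (P : {set gpath G}) : bool :=
  path_partition P && [forall p in P, isometric_path p].

Definition path1 x : gpath G :=
  @GPath G (x, [bseq] : #|G|.-bseq G) isT.

Definition singletons : {set gpath G} := [set path1 x | x : G].

Lemma pverts_path1 x : pverts (path1 x) = [set x].
Proof. by apply/setP=> y; rewrite !inE. Qed.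

Lemma path_partition_singletons : path_partition singletons.
Proof.
apply/andP; split.
  apply/eqP/setP=> x; rewrite inE; apply/bigcupP; exists (path1 x).
    exact: imset_f.
  by rewrite pverts_path1 set11.
apply/forall_inP=> _ /imsetP[x _ ->]; apply/forall_inP=> _ /imsetP[y _ ->].
apply/implyP=> neq; rewrite !pverts_path1 disjoints1 inE.
by apply: contraNneq neq => ->.
Qed.

Lemma induced_path_partition_singletons : induced_path_partition singletons.
Proof.
rewrite /induced_path_partition path_partition_singletons.
apply/forall_inP=> _ /imsetP[x _ ->].
apply/forall_inP=> y; rewrite pverts_path1 => /set1P->.
apply/forall_inP=> z /set1P->.
by rewrite adj_irr /padj /= eqxx.
Qed.

Lemma isometric_path_partition_singletons : isometric_path_partition singletons.
Proof.
rewrite /isometric_path_partition path_partition_singletons.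
by apply/forall_inP=> _ /imsetP[x _ ->]; apply/forallP=> q; apply/implyP.
Qed.

Lemma ex_card_such (A : pred {set gpath G}) (P : {set gpath G}) :
  A P -> exists n, [exists Q, A Q && (#|Q| == n)].
Proof. by move=> AP; exists #|P|; apply/existsP; exists P; rewrite AP eqxx. Qed.

Definition pp : nat := ex_minn (ex_card_such path_partition_singletons).
Definition indpp : nat :=
  ex_minn (ex_card_such induced_path_partition_singletons).
Definition ipp : nat :=
  ex_minn (ex_card_such isometric_path_partition_singletons).

Definition edges : {set {set G}} :=
  [set E : {set G} | [exists x, exists y, adj x y && (E == [set x; y])]].

Definition matching (M : {set {set G}}) : bool :=
  (M \subset edges) && trivIset M.

Definition matching_number : nat := \max_(M : {set {set G}} | matching M) #|M|.

(* The subtraction does not truncate: a matching with k edges covers 2k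
   vertices. *)
Definition PP_extremal : Prop := pp = #|G| - matching_number.

Definition components : {set {set G}} :=
  equivalence_partition (connect (@adj G)) [set: G].

End Paths.

(* Main.v *)
Require Import Defs.
From mathcomp Require Import all_boot.

(** A maximum matching, together with the singletons of the vertices that it
    leaves uncovered, splits the vertices into #|G| - nu blocks, each of which
    is the vertex set of an edge or of a single vertex
    ([matching_blocks_partition], [card_matching_blocks]).  Paths with at most
    one edge are both induced and isometric, so pp, indpp and ipp are all at
    most #|G| - nu ([short_path_partition]).

    This bound can be improved for pp as soon as some edge uv lies outside the
    matching: every vertex of such a small block is an end of a path through
    that block, so the block of u and the block of v can be glued along uv into
    one longer path ([edge_outside_matching]).  Hence in a PP-extremal graph all
    edges belong to one matching, that is, no vertex has two neighbours, which
    says that no component has more than two vertices ([small_components]).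

    Conversely, if no vertex has two neighbours then every path has at most two
    vertices.  The two-vertex members of a path partition form a matching, and
    counting vertices gives #|G| <= #|P| + nu for every path partition P
    ([small_path_partition]), so that the three parameters are equal to
    #|G| - nu. *)

Set Implicit Arguments.
Unset Strict Implicit.
Unset Printing Implicit Defensive.

(** * Merging two blocks of a partition *)

Lemma merge_partition (T : finType) (S : {set {set T}}) (D A B : {set T}) :
  partition S D -> A \in S -> B \in S -> A != B ->
  exists2 S' : {set {set T}},
    partition S' D & #|S'| < #|S| /\ {subset S' <= A :|: B |: S}.
Proof.
case/and3P=> /eqP covS /trivIsetP trS S0 AS BS neqAB.
have sub C : C \in S :\ A :\ B -> [/\ C \in S, C != A & C != B].
  by rewrite !inE => /and3P[].
exists (A :|: B |: S :\ A :\ B); last split.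
- apply/and3P; split.
  + apply/eqP/setP=> x; rewrite -covS; apply/bigcupP/bigcupP=> -[C].
      case/setU1P=> [->|/sub[CS _ _]] xC; last by exists C.
      by case/setUP: xC => xC; [exists A | exists B].
    move=> CS xC; have [eqC|neqCA] := eqVneq C A.
      by exists (A :|: B); rewrite ?setU11 // inE -eqC xC.
    have [eqC|neqCB] := eqVneq C B.
      by exists (A :|: B); rewrite ?setU11 // inE -eqC xC orbT.
    by exists C; rewrite // !inE CS neqCA neqCB orbT.
  + have dis C : C \in S :\ A :\ B -> [disjoint A :|: B & C].
      case/sub=> CS CA CB; rewrite -setI_eq0 setIUl setU_eq0 !setI_eq0.
      by rewrite !trS // eq_sym.
    apply/trivIsetP=> C E /setU1P[->|CS] /setU1P[->|ES].
    * by rewrite eqxx.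
    * by move=> _; apply: dis.
    * by move=> _; rewrite disjoint_sym; apply: dis.
    * by move=> CE; case: (sub _ CS) (sub _ ES) => ? _ _ [? _ _]; apply: trS.
  + apply/setU1P=> -[/esym/eqP|/sub[]]; last by rewrite (negPf S0).
    by rewrite setU_eq0 => /andP[/eqP A0 _]; rewrite A0 (negPf S0) in AS.
- rewrite (cardsD1 A S) AS (cardsD1 B (S :\ A)) !inE eq_sym neqAB BS cardsU1.
  by rewrite ltnS leq_add2r leq_b1.
- by move=> C /setU1P[->|/sub[CS _ _]]; rewrite ?setU11 // inE CS orbT.
Qed.

(** * Paths with at most one edge *)

Section Graph.
Variable G : sgraph.
Implicit Types (x y z : G) (s : seq G) (p q : gpath G) (P : {set gpath G}).
Implicit Types (A B : {set G}) (S M : {set {set G}}).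

Lemma gpath_of_seq x s :
  path (@adj G) x s -> uniq (x :: s) ->
  exists p, psrc p = x /\ ptail p = s.
Proof.
move=> xs us.
have sz : size s <= #|G|.
  by rewrite ltnW // -[_.+1]/(size (x :: s)) -(card_uniqP us) max_card.
have gP : is_path (x, Bseq sz) by rewrite /is_path /= xs.
by exists (GPath gP).
Qed.

Lemma ptail_path p : path (@adj G) (psrc p) (ptail p).
Proof. by case/andP: (valP p). Qed.

Lemma pseq_uniq p : uniq (pseq p).
Proof. by case/andP: (valP p). Qed.

Lemma card_pverts p : #|pverts p| = (plength p).+1.
Proof. by rewrite cardsE (card_uniqP (pseq_uniq p)). Qed.

Lemma short_path_induced p : plength p <= 1 -> induced_path p.
Proof.
move: (ptail_path p) (pseq_uniq p); rewrite /induced_path /pverts /padj /pseq.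
rewrite /plength; move: (psrc p) (ptail p) => x [|y [|//]] /= xy u _.
  apply/forall_inP=> a; rewrite !inE => /eqP->.
  apply/forall_inP=> b; rewrite !inE => /eqP->.
  by rewrite adj_irr /= eqxx.
have neq : x != y by move: u; rewrite inE andbT.
have xyF : (x == y) = false by apply: negbTE.
have yxF : (y == x) = false by rewrite eq_sym.
have {xy} adjxy : adj x y by case/andP: xy.
have adjyx : adj y x by rewrite adj_sym.
apply/forall_inP=> a; rewrite !inE => /orP[]/eqP->;
apply/forall_inP=> b; rewrite !inE => /orP[]/eqP->;
by rewrite ?adj_irr ?adjxy ?adjyx /= ?eqxx ?xyF ?yxF.
Qed.

Lemma short_path_isometric p : plength p <= 1 -> isometric_path p.
Proof.
move=> short; apply/forallP=> q; apply/implyP=> /andP[/eqP src /eqP tgt].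
case: (posnP (plength q)) => [q0|]; last exact: leq_trans.
move: (pseq_uniq p) short src tgt q0; rewrite /ptgt /plength /pseq.
case: (ptail q) => // ; case: (ptail p) => [|y [|//]] //= u _ -> eqxy _.
by move: u; rewrite eqxy mem_head.
Qed.

(** * Path partition numbers and partitions into blocks *)

Lemma pp_min P : path_partition P -> pp G <= #|P|.
Proof.
by rewrite /pp => partP; case: ex_minnP => m _; apply; apply/existsP; exists P;
  rewrite partP eqxx.
Qed.

Lemma indpp_min P : induced_path_partition P -> indpp G <= #|P|.
Proof.
by rewrite /indpp => partP; case: ex_minnP => m _; apply; apply/existsP;
  exists P; rewrite partP eqxx.
Qed.

Lemma ipp_min P : isometric_path_partition P -> ipp G <= #|P|.
Proof.
by rewrite /ipp => partP; case: ex_minnP => m _; apply; apply/existsP;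
  exists P; rewrite partP eqxx.
Qed.

Lemma pp_witness : exists2 P : {set gpath G}, path_partition P & #|P| = pp G.
Proof.
by rewrite /pp; case: ex_minnP => m /existsP[P /andP[? /eqP ?]] _; exists P.
Qed.

Lemma indpp_witness :
  exists2 P : {set gpath G}, induced_path_partition P & #|P| = indpp G.
Proof.
by rewrite /indpp; case: ex_minnP => m /existsP[P /andP[? /eqP ?]] _; exists P.
Qed.

Lemma ipp_witness :
  exists2 P : {set gpath G}, isometric_path_partition P & #|P| = ipp G.
Proof.
by rewrite /ipp; case: ex_minnP => m /existsP[P /andP[? /eqP ?]] _; exists P.
Qed.

Lemma pp_le_indpp : pp G <= indpp G.
Proof. by have [P /andP[partP _] <-] := indpp_witness; apply: pp_min. Qed.

Lemma pp_le_ipp : pp G <= ipp G.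
Proof. by have [P /andP[partP _] <-] := ipp_witness; apply: pp_min. Qed.

(** This reduces building small path partitions to building partitions of the
    vertex set, by choosing one path for each block; Q records what the chosen
    paths satisfy. *)
Lemma path_partition_of_blocks S (Q : pred (gpath G)) :
  partition S [set: G] ->
  (forall A, A \in S -> exists2 p, Q p & pverts p = A) ->
  exists2 P : {set gpath G}, path_partition P &
    #|P| <= #|S| /\ {in P, forall p, Q p}.
Proof.
case/and3P=> /eqP covS /trivIsetP trS _ ex.
have exb A : A \in S -> exists p, Q p && (pverts p == A).
  by case/ex=> p Qp eqA; exists p; rewrite Qp eqA eqxx.
pose f A := odflt (path1 (enum_val (Ordinal (nonnull G))))
  [pick p | Q p && (pverts p == A)].
have fP A : A \in S -> Q (f A) /\ pverts (f A) = A.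
  move=> /exb[p pP]; rewrite /f; case: pickP => [q /andP[? /eqP ?] //|none].
  by rewrite none in pP.
exists (f @: S); last split.
- apply/andP; split.
    apply/eqP; rewrite -covS; apply/setP=> x; apply/bigcupP/bigcupP=> -[].
      by move=> _ /imsetP[A AS ->]; rewrite (fP _ AS).2 => ?; exists A.
    move=> A AS xA; exists (f A); first exact: imset_f.
    by rewrite (fP _ AS).2.
  apply/forall_inP=> _ /imsetP[A AS ->]; apply/forall_inP=> _ /imsetP[B BS ->].
  apply/implyP=> neq; rewrite (fP _ AS).2 (fP _ BS).2; apply: trS => //.
  by apply: contraNneq neq => ->.
- exact: leq_imset_card.
- by move=> _ /imsetP[A AS ->]; case: (fP _ AS).
Qed.

Lemma pverts_partition P :
  path_partition P -> partition (@pverts G @: P) [set: G].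
Proof.
case/andP=> /eqP covP /forall_inP disP; apply/and3P; split.
- by rewrite cover_imset covP.
- apply/trivIsetP=> _ _ /imsetP[p pP ->] /imsetP[q qP ->] neq.
  move/forall_inP/(_ q qP)/implyP: (disP p pP); apply.
  by apply: contraNneq neq => ->.
- by apply/imsetP=> -[p _ /esym/eqP]; rewrite -cards_eq0 card_pverts.
Qed.

(** * The path partition of a maximum matching *)

Lemma edgeP A : reflect (exists x y, adj x y /\ A = [set x; y]) (A \in edges G).
Proof.
rewrite inE; apply: (iffP existsP) => -[x].
  by case/existsP=> y /andP[xy /eqP->]; exists x, y.
by case=> y [xy ->]; exists x; apply/existsP; exists y; rewrite xy eqxx.
Qed.

Lemma adj_neq x y : adj x y -> x != y.
Proof. by apply: contraTneq => ->; rewrite adj_irr. Qed.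

Lemma card_edge A : A \in edges G -> #|A| = 2.
Proof. by case/edgeP=> x [y [/adj_neq xy ->]]; rewrite cards2 xy. Qed.

Definition matching_blocks M : {set {set G}} :=
  M :|: [set [set x] | x in ~: cover M].

Lemma matching_blocks_partition M :
  matching M -> partition (matching_blocks M) [set: G].
Proof.
case/andP=> /subsetP sM /trivIsetP trM; apply/and3P; split.
- apply/eqP/setP=> x; rewrite inE; apply/bigcupP.
  have [/bigcupP[A AM xA]|xM] := boolP (x \in cover M).
    by exists A; rewrite // inE AM.
  by exists [set x]; rewrite ?set11 // inE imset_f ?orbT // inE.
- have dis A x : A \in M -> x \in ~: cover M -> [disjoint A & [set x]].
    move=> AM; rewrite inE disjoint_sym disjoints1; apply: contra => xA.
    by apply/bigcupP; exists A.
  apply/trivIsetP=> A B /setUP[AM|/imsetP[x xM ->]] /setUP[BM|/imsetP[y yM ->]].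
  + exact: trM.
  + by move=> _; apply: dis.
  + by move=> _; rewrite disjoint_sym; apply: dis.
  + by move=> neq; rewrite disjoints1 inE; apply: contraNneq neq => ->.
- apply/setUP=> -[/sM/card_edge|/imsetP[x _ /esym/eqP]].
    by rewrite cards0.
  by rewrite -cards_eq0 cards1.
Qed.

Lemma card_matching_blocks M :
  matching M -> #|matching_blocks M| <= #|G| - #|M|.
Proof.
case/andP=> /subsetP sM trM.
have cov : #|cover M| = #|M| + #|M|.
  rewrite addnn -muln2 -(eqP trM) -sum_nat_const.
  by apply: eq_bigr => A /sM/card_edge.
apply: leq_trans (leq_card_setU _ _).1 _.
rewrite card_imset; last exact: set1_inj.
rewrite -(cardsC (cover M)) cov -!addnA addKn.
exact: leqnn.
Qed.

(** A path with at most two vertices can be traversed starting from any of its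
    vertices, so a block can be glued to another one at whichever vertex is
    needed. *)
Lemma matching_blocks_path M A x :
  matching M -> A \in matching_blocks M -> x \in A ->
  exists s, [/\ path (@adj G) x s, uniq (x :: s), size s <= 1 &
                A = [set y in x :: s]].
Proof.
case/andP=> /subsetP sM _ /setUP[/sM/edgeP[y [z [yz ->]]]|/imsetP[y _ ->]].
  have neq := adj_neq yz.
  case/set2P=> ->; [exists [:: z] | exists [:: y]]; split=> //=.
  - by rewrite yz.
  - by rewrite inE neq.
  - by apply/setP=> t; rewrite !inE.
  - by rewrite adj_sym yz.
  - by rewrite inE eq_sym neq.
  - by apply/setP=> t; rewrite !inE orbC.
move/set1P->; exists [::]; split=> //.
by apply/setP=> t; rewrite !inE.
Qed.

Lemma matching_blocks_short M A :
  matching M -> A \in matching_blocks M ->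
  exists2 p, plength p <= 1 & pverts p = A.
Proof.
move=> mM AS; have /and3P[_ _ S0] := matching_blocks_partition mM.
have [A0|[x xA]] := set_0Vmem A; first by rewrite -A0 AS in S0.
have [s [xs us sz ->]] := matching_blocks_path mM AS xA.
have [p [px ps]] := gpath_of_seq xs us.
by exists p; rewrite /plength /pverts /pseq ?px ps.
Qed.

Lemma maximum_matching :
  exists2 M : {set {set G}}, matching M & #|M| = matching_number G.
Proof.
have m0 : matching (set0 : {set {set G}}).
  by rewrite /matching sub0set; apply/trivIsetP=> A B; rewrite inE.
have [|M mM eqM] := @eq_bigmax_cond _ (@matching G) (fun M => #|M|).
  by apply/card_gt0P; exists set0.
by exists M; rewrite // /matching_number eqM.
Qed.

Lemma short_path_partition :
  exists2 P : {set gpath G}, path_partition P &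
    #|P| <= #|G| - matching_number G /\ {in P, forall p, plength p <= 1}.
Proof.
have [M mM <-] := maximum_matching.
have [P pP [cP sP]] := path_partition_of_blocks (matching_blocks_partition mM)
  (fun A AS => matching_blocks_short mM AS).
by exists P => //; split=> //; apply: leq_trans cP (card_matching_blocks mM).
Qed.

Lemma indpp_le : indpp G <= #|G| - matching_number G.
Proof.
have [P pP [cP sP]] := short_path_partition.
apply: leq_trans cP; apply: indpp_min; rewrite /induced_path_partition pP.
by apply/forall_inP=> p /sP; apply: short_path_induced.
Qed.

Lemma ipp_le : ipp G <= #|G| - matching_number G.
Proof.
have [P pP [cP sP]] := short_path_partition.
apply: leq_trans cP; apply: ipp_min; rewrite /isometric_path_partition pP.
by apply/forall_inP=> p /sP; apply: short_path_isometric.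
Qed.

(** * Improving on a matching *)

(** The first path is stored with its gluing end x at the head, hence it is
    traversed in reverse. *)
Lemma concat_path x s y t :
  path (@adj G) x s -> path (@adj G) y t -> adj x y ->
  uniq (x :: s) -> uniq (y :: t) ->
  [disjoint [set z in x :: s] & [set z in y :: t]] ->
  exists p, pverts p = [set z in x :: s] :|: [set z in y :: t].
Proof.
move=> xs yt xy us ut dis.
have sortc : sorted (@adj G) (rev (x :: s) ++ y :: t).
  have: sorted (@adj G) (rev (x :: s)).
    rewrite rev_sorted /=; rewrite -(eq_path (e := @adj G)) // => a b.
    exact: adj_sym.
  have : last x (rev (x :: s)) = x by rewrite rev_cons last_rcons.
  case: (rev (x :: s)) (size_rev (x :: s)) => //= a r _ lr ar.
  by rewrite cat_path ar /= lr xy.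
have uniqc : uniq (rev (x :: s) ++ y :: t).
  rewrite cat_uniq rev_uniq us ut andbT andTb.
  apply/negP=> /hasP[z zt]; rewrite /= mem_rev => zs.
  have := disjointFr (x := z) dis.
  by rewrite 2!in_set zs zt => /(_ isT).
have eqc : [set z in rev (x :: s) ++ y :: t] =
    [set z in x :: s] :|: [set z in y :: t].
  by apply/setP=> z; rewrite !inE mem_cat mem_rev !in_cons.
move: sortc uniqc eqc; case: (rev (x :: s) ++ y :: t) => [|a r] /= ar ur eqc.
  by move/setP/(_ x): eqc; rewrite !inE eqxx.
have [p [pa pr]] := gpath_of_seq ar ur.
by exists p; rewrite -eqc /pverts /pseq pa pr.
Qed.

(** An edge outside the matching joins two distinct blocks, which it glues into
    a single path, thereby saving one path. *)
Lemma edge_outside_matching M x y :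
  matching M -> adj x y -> [set x; y] \notin M -> pp G < #|G| - #|M|.
Proof.
move=> mM xy xyM; have partS := matching_blocks_partition mM.
have /and3P[/eqP covS trS _] := partS.
have [A AS xA] : exists2 A, A \in matching_blocks M & x \in A.
  by apply/bigcupP; rewrite -/(cover _) covS.
have [B BS yB] : exists2 B, B \in matching_blocks M & y \in B.
  by apply/bigcupP; rewrite -/(cover _) covS.
have neqAB : A != B.
  apply: contraNneq xyM => eqAB; rewrite -eqAB in yB.
  have neq := adj_neq xy.
  case/setUP: (AS) => [AM|/imsetP[z _ Az]]; last first.
    by move: neq; rewrite Az in xA yB; rewrite (set1P xA) (set1P yB) eqxx.
  suff <- : A = [set x; y] by [].
  apply/esym/eqP; rewrite eqEcard subUset !sub1set xA yB cards2 neq.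
  by case/andP: mM => /subsetP sM _; rewrite (card_edge (sM _ AM)).
have [s [xs us _ eqA]] := matching_blocks_path mM AS xA.
have [t [yt ut _ eqB]] := matching_blocks_path mM BS yB.
have dis := trivIsetP trS _ _ AS BS neqAB.
have [q qAB] : exists q, pverts q = A :|: B.
  by rewrite eqA eqB in dis *; apply: concat_path.
have [S' partS' [cS' sS']] := merge_partition partS AS BS neqAB.
have [|P pP [cP _]] := path_partition_of_blocks (Q := predT) partS'.
  move=> C /sS'/setU1P[->|CS]; first by exists q.
  by have [p _ pC] := matching_blocks_short mM CS; exists p.
apply: leq_ltn_trans (pp_min pP) _; apply: leq_ltn_trans cP _.
exact: leq_trans cS' (card_matching_blocks mM).
Qed.

(** * Components with at most two vertices *)

Definition unique_neighbours := forall x y z, adj x y -> adj x z -> y = z.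

(** When neighbours are unique, adjacent vertices x and y are each other's only
    neighbour, so a walk from x never leaves {x, y}; conversely a vertex and two
    of its neighbours lie in the same component. *)
Lemma small_components :
  ~ (exists C, C \in components G /\ 2 < #|C|) <-> unique_neighbours.
Proof.
split=> [small x y z xy xz|un [C [/imsetP[x _ ->]]]].
  apply/eqP/idPn=> neq; apply: small.
  exists [set w in [set: G] | connect (@adj G) x w]; split.
    exact: imset_f.
  have <- : #|[set x; y; z]| = 3.
    by rewrite -setUA cardsU1 cards2 neq !inE negb_or !adj_neq.
  apply: subset_leq_card; apply/subsetP=> w; rewrite !inE /=.
  case/orP=> [/orP[]|] /eqP->; [exact: connect0 | exact: connect1..].
have nbr w : connect (@adj G) x w -> w = x \/ adj x w.
  case/connectP=> s xs ->; elim: s x xs => [|z s IHs] x0 /=; first by left.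
  case/andP=> xz /IHs[->|zl]; first by right.
  by left; apply: un zl _; rewrite adj_sym.
apply/negP; rewrite -leqNgt.
suff [z sub] : exists z,
    [set w in [set: G] | connect (@adj G) x w] \subset [set x; z].
  by apply: leq_trans (subset_leq_card sub) _; rewrite cards2; case: eqP.
case: (pickP (adj x)) => [z xz|none].
  exists z; apply/subsetP=> w; rewrite !inE /= => /nbr[->|xw].
    by rewrite eqxx.
  by rewrite (un _ _ _ xw xz) eqxx orbT.
exists x; apply/subsetP=> w; rewrite !inE /= => /nbr[->|xw].
  by rewrite eqxx.
by rewrite none in xw.
Qed.

Lemma unique_neighbours_plength p : unique_neighbours -> plength p <= 1.
Proof.
move=> un; move: (ptail_path p) (pseq_uniq p); rewrite /plength /pseq.
case: (ptail p) => [|y [|z s]] //= /and3P[xy yz _].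
have -> : psrc p = z by apply: un yz; rewrite adj_sym.
by rewrite !inE eqxx orbT.
Qed.

(** Every member of P has one or two vertices, and those with two are the edges
    of a matching; so counting vertices gives #|P| plus the size of this
    matching. *)
Lemma small_path_partition P :
  unique_neighbours -> path_partition P -> #|G| <= #|P| + matching_number G.
Proof.
move=> un partP; have partS := pverts_partition partP.
set S := _ @: P in partS.
have sz A : A \in S -> #|A| = 1 + (#|A| == 2).
  case/imsetP=> p _ ->; rewrite card_pverts.
  by case: (plength p) (unique_neighbours_plength p un) => [|[]].
pose M := [set A in S | #|A| == 2].
have mM : matching M.
  apply/andP; split.
    apply/subsetP=> A; rewrite inE => /andP[/imsetP[p _ ->]].
    rewrite card_pverts eqSS => lp; apply/edgeP.
    move: lp (ptail_path p); rewrite /plength /pverts /pseq.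
    case: (ptail p) => [|y []] //= _ /andP[xy _].
    exists (psrc p), y; split=> //.
    by apply/setP=> z; rewrite !inE.
  case/and3P: partS => _ trS _; apply: trivIsetS trS.
  by apply/subsetP=> A; rewrite inE => /andP[].
rewrite -cardsT (card_partition partS) (eq_bigr _ sz) big_split /= sum1_card.
rewrite -big_mkcondr /= sum1dep_card leq_add ?leq_imset_card //.
exact: (@leq_bigmax_cond _ (@matching G) (fun M => #|M|) M mM).
Qed.

End Graph.

(** * The equivalence *)

Theorem proposition1p6 (G : sgraph) :
  [<-> PP_extremal G;
       [/\ pp G = indpp G, indpp G = ipp G & ipp G = #|G| - matching_number G];
       ~ exists C : {set G}, C \in components G /\ 2 < #|C|].
Proof.
have extremal_small : PP_extremal G -> unique_neighbours G.
  rewrite /PP_extremal => ext x y z xy xz; have [M mM cM] := maximum_matching G.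
  have inM u v : adj u v -> [set u; v] \in M.
    move=> uv; apply: contraT => /(edge_outside_matching mM uv).
    by rewrite cM ext ltnn.
  (* Two distinct edges of a matching cannot share the vertex x. *)
  case/andP: mM => _ /trivIsetP trM; apply/eqP; apply: contraT => neq.
  have /trM : [set x; y] != [set x; z].
    apply: contra neq => /eqP/setP/(_ y).
    by rewrite !inE eqxx orbT eq_sym (negPf (adj_neq xy)) => /esym.
  move=> /(_ (inM _ _ xy) (inM _ _ xz)) dis; have := disjointFr (x := x) dis.
  by rewrite !inE eqxx => /(_ isT).
have small_all : unique_neighbours G ->
    [/\ pp G = indpp G, indpp G = ipp G & ipp G = #|G| - matching_number G].
  move=> un; have lower : #|G| - matching_number G <= pp G.
    have [P partP <-] := pp_witness G.
    by rewrite leq_subLR addnC small_path_partition.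
  have eqn m : pp G <= m -> m <= #|G| - matching_number G ->
      m = #|G| - matching_number G.
    by move=> lem mle; apply/eqP; rewrite eqn_leq mle (leq_trans lower).
  rewrite (eqn _ (pp_le_ipp G) (ipp_le G)) (eqn _ (pp_le_indpp G) (indpp_le G)).
  split=> //; apply: eqn => //.
  exact: leq_trans (pp_le_ipp G) (ipp_le G).
tfae.
- by move/extremal_small/small_all.
- case=> pi ii ie; apply/small_components/extremal_small.
  by rewrite /PP_extremal pi ii.
- by case/small_components/small_all=> pi ii ie; rewrite /PP_extremal pi ii.
Qed.
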